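(* Let $k\geq 0$ be an integer and let $G$ be a finite simple graph with at most $k$ pairwise vertex disjoint cycles. Then \[ \mathbf{c}(G)\leq \ell(g(1))\,\ell(g(2))\cdots \ell(g(k)) \] (the empty product, for $k=0$, being $1$).
   Context: For a finite simple graph $G$, its independence complex $\mathrm{Ind}(G)$ is the set of all independent vertex subsets of $G$ (including the empty set), partially ordered by inclusion. A matching on this poset is a set of pairs $\{\sigma,\tau\}$ with $\tau$ covering $\sigma$ (i.e. $\sigma\subset\tau$, $|\tau|=|\sigma|+1$), such that distinct pairs are disjoint. A sequence of $n>1$ distinct pairs $\{\sigma_1\subset\tau_1\},\ldots,\{\sigma_n\subset\tau_n\}$ of the matching is a cycle if $\tau_i\supset\sigma_{i+1}$ for $1\leq i<n$ and $\tau_n\supset\sigma_1$; the matching is acyclic if it has no cycles. Elements not in any matched pair are critical. $\mathbf{c}(G)$ is the minimal number of critical elements over all acyclic matchings on $\mathrm{Ind}(G)$. The effective girth of a graph is the smallest number of vertices of degree at least three lying on a common cycle. For integers $k\geq 1$, $g(k)$ is the maximal effective girth of a graph of minimal degree at least two with at most $k$ vertex disjoint cycles. Fibonacci numbers: $\varphi(0)=0$, $\varphi(1)=1$, $\varphi(n)=\varphi(n-1)+\varphi(n-2)$; Lucas numbers: $\ell(n)=\varphi(n-1)+\varphi(n+1)$. *)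

(* Defs.v *)
From mathcomp Require Import all_boot.
Set Implicit Arguments. Unset Strict Implicit. Unset Printing Implicit Defensive.

Fixpoint fib (n : nat) : nat :=
  match n with
  | 0 => 0
  | 1 => 1
  | S ((S m) as p) => fib p + fib m
  end.

(* Lucas numbers l(n) = fib(n-1) + fib(n+1); only used for n >= 1. *)
Definition lucas (n : nat) : nat := fib n.-1 + fib n.+1.

Definition simple_graph (T : finType) (e : rel T) : Prop :=
  symmetric e /\ irreflexive e.

Definition deg (T : finType) (e : rel T) (x : T) : nat := #|[set y | e x y]|.

Definition gcycle (T : finType) (e : rel T) (c : seq T) : Prop :=
  [/\ 3 <= size c, uniq c & cycle e c].

Definition disjoint_cycles (T : finType) (e : rel T) (cs : seq (seq T)) : Prop :=
  (forall c, c \in cs -> gcycle e c) /\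
  pairwise (fun c d : seq T => [disjoint c & d]) cs.

Definition at_most_disjoint_cycles (T : finType) (e : rel T) (k : nat) : Prop :=
  ~ (exists cs : seq (seq T), size cs = k.+1 /\ disjoint_cycles e cs).

Definition min_deg_ge2 (T : finType) (e : rel T) : Prop := forall x, 2 <= deg e x.

Definition high_on (T : finType) (e : rel T) (c : seq T) : nat :=
  count (fun x => 3 <= deg e x) c.

Definition eff_girth_is (T : finType) (e : rel T) (m : nat) : Prop :=
  (exists c, gcycle e c /\ high_on e c = m) /\
  (forall c, gcycle e c -> m <= high_on e c).

Definition g_is (k m : nat) : Prop :=
  (exists (T : finType) (e : rel T),
      [/\ simple_graph e, min_deg_ge2 e, at_most_disjoint_cycles e k & eff_girth_is e m]) /\
  (forall (T : finType) (e : rel T) (m' : nat),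
      [/\ simple_graph e, min_deg_ge2 e, at_most_disjoint_cycles e k & eff_girth_is e m'] ->
      m' <= m).

Definition indep (T : finType) (e : rel T) (A : {set T}) : bool :=
  [forall x in A, forall y in A, ~~ e x y].

Definition is_matching (T : finType) (e : rel T) (M : {set ({set T} * {set T})}) : Prop :=
  (forall p, p \in M ->
     [/\ indep e p.1, indep e p.2, p.1 \subset p.2 & #|p.2| = #|p.1|.+1]) /\
  (forall p q, p \in M -> q \in M -> p != q ->
     [disjoint [set p.1; p.2] & [set q.1; q.2]]).

Definition matching_cycle (T : finType) (M : {set ({set T} * {set T})})
    (cs : seq ({set T} * {set T})) : Prop :=
  [/\ 1 < size cs, uniq cs, {subset cs <= M} &
      forall i, i < size cs ->
        (nth (set0, set0) cs (i.+1 %% size cs)).1 \subset (nth (set0, set0) cs i).2].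

Definition acyclic_matching (T : finType) (M : {set ({set T} * {set T})}) : Prop :=
  forall cs, ~ matching_cycle M cs.

Definition n_critical (T : finType) (e : rel T) (M : {set ({set T} * {set T})}) : nat :=
  #|[set s : {set T} | indep e s & [forall p in M, (p.1 != s) && (p.2 != s)]]|.

Definition c_is (T : finType) (e : rel T) (n : nat) : Prop :=
  (exists M, [/\ is_matching e M, acyclic_matching M & n_critical e M = n]) /\
  (forall M, is_matching e M -> acyclic_matching M -> n <= n_critical e M).

(* Main.v *)
Require Import Defs.
From mathcomp Require Import all_boot.
From mathcomp Require Import zify.
Set Implicit Arguments. Unset Strict Implicit. Unset Printing Implicit Defensive.

(**
Splitting independent sets according to whether they contain a vertex v gives
c(V) <= c(V - v) + c(V - N[v]), and c(V) = 0 as soon as V has an isolated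
vertex; hence c(V) <= c(V - N[v]) when v is the neighbour of a leaf. Leaves are
removed this way until the minimal degree is two. Then a cycle with at most
g(k) vertices of degree at least three is consumed by branching along it: a
vertex of degree two is never branched on, because once its predecessor is
decided it is either already removed or a leaf. The number of resulting
subproblems is a count of closed walks bounded by a Lucas number, and each
subproblem avoids the cycle, so it has at most k - 1 disjoint cycles.
*)

(** * Acyclic matchings from a branching scheme *)

Section MatchingTree.

Variables (T : finType) (e : rel T).

Definition nbhd (x : T) : {set T} := [set y | e x y].

(** A derivation tells how to build a matching on the independent subsets of [V] with at most the
    given number of critical sets. With no vertices the empty set is critical; an isolated vertex
    allows everything to be matched. *)
Inductive mtree : {set T} -> nat -> Prop :=
| MTEmpty : mtree set0 1
| MTIsolated (V : {set T}) u :
    u \in V -> (forall w, w \in V -> ~~ e u w) -> mtree V 0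
| MTBranch (V : {set T}) v a b :
    v \in V -> mtree (V :\ v) a -> mtree (V :\ v :\: nbhd v) b ->
    mtree V (a + b).

Definition partner (p : {set T} * {set T}) (s : {set T}) : bool :=
  (p.1 == s) || (p.2 == s).

(* Acyclicity is witnessed by a rank that decreases along every step of a
   would-be cycle; such ranks glue easily when matchings are united. *)
Definition ranked_matching (V : {set T}) (M : {set ({set T} * {set T})})
    (f : {set T} * {set T} -> nat) : Prop :=
  [/\ forall p, p \in M -> [/\ indep e p.1, indep e p.2, p.1 \subset p.2,
                            #|p.2| = #|p.1|.+1 & p.2 \subset V],
      forall p q s, p \in M -> q \in M -> partner p s -> partner q s -> p = q
    & forall p q, p \in M -> q \in M -> p != q -> q.1 \subset p.2 -> f q < f p].

Definition critical (V : {set T}) (M : {set ({set T} * {set T})}) : {set {set T}} :=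
  [set s : {set T} | [&& s \subset V, indep e s & [forall p in M, ~~ partner p s]]].

Lemma ranked_matching_acyclic V M f : ranked_matching V M f -> acyclic_matching M.
Proof.
case=> _ _ desc cs [n1 csU csM step].
set d := (set0, set0) in step.
have dec i : i < size cs -> f (nth d cs (i.+1 %% size cs)) < f (nth d cs i).
  move=> lti; have lt2 : i.+1 %% size cs < size cs by rewrite ltn_mod; lia.
  apply: desc; rewrite ?csM ?mem_nth ?step // nth_uniq //.
  (* Cyclically consecutive pairs differ because the length exceeds one. *)
  case: (ltngtP i.+1 (size cs)) => [lt|gt|eq]; first by rewrite modn_small //; lia.
    lia.
  by rewrite eq modnn; lia.
have bound i : i < size cs -> f (nth d cs i) + i <= f (nth d cs 0).
  elim: i => [|i IH] lti; first by rewrite addn0.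
  have := dec i (ltnW lti); rewrite modn_small //.
  by have := IH (ltnW lti); lia.
have lt : (size cs).-1 < size cs by lia.
have := dec _ lt; have := bound _ lt.
by rewrite prednK ?modnn; lia.
Qed.

Lemma indepP (A : {set T}) :
  reflect (forall x y, x \in A -> y \in A -> ~~ e x y) (indep e A).
Proof.
apply: (iffP forall_inP) => [H x y xA yA|H x xA].
  exact: (forall_inP (H x xA)).
by apply/forall_inP => y yA; apply: H.
Qed.

Hypothesis simple : simple_graph e.

Lemma indep_setU1 v (s : {set T}) :
  indep e s -> (forall w, w \in s -> ~~ e v w) -> indep e (v |: s).
Proof.
have [sym irr] := simple.
move=> /indepP si sv; apply/indepP => x y.
case/setU1P=> [->|xs] /setU1P[->|ys]; last exact: si.
- by rewrite irr.
- exact: sv.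
- by rewrite sym sv.
Qed.

Lemma indepS (s t : {set T}) : s \subset t -> indep e t -> indep e s.
Proof. by move=> /subsetP st /indepP ti; apply/indepP => x y /st ? /st ?; apply: ti. Qed.

Lemma ranked_matching_empty :
  ranked_matching set0 set0 (fun=> 0) /\ #|critical set0 set0| <= 1.
Proof.
split; first by split=> [p|p q s|p q]; rewrite inE.
rewrite -(cards1 (set0 : {set T})); apply/subset_leq_card/subsetP => s.
by rewrite !inE subset0 => /andP[].
Qed.

(** Match [s] with [u |: s]. Another lower set inside [u |: s] avoids [u], hence is a proper subset
    of [s], so cardinality serves as rank. *)
Lemma ranked_matching_isolated (V : {set T}) u :
  u \in V -> (forall w, w \in V -> ~~ e u w) ->
  exists M f, ranked_matching V M f /\ #|critical V M| <= 0.
Proof.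
move=> uV uiso.
pose M := [set (s, u |: s) | s in [set s : {set T} | (s \subset V :\ u) && indep e s]].
exists M, (fun p : {set T} * {set T} => #|p.1|).
have nu (s : {set T}) : s \subset V :\ u -> u \notin s.
  by move/subsetP=> sV; apply/negP => /sV; rewrite !inE eqxx.
have add_u (s : {set T}) : s \subset V :\ u -> indep e s -> indep e (u |: s).
  move=> sV si; apply: indep_setU1 => // w ws; apply: uiso.
  by have := subsetP sV w ws; rewrite inE => /andP[].
split; first split.
- move=> _ /imsetP[s /[!inE] /andP[sV si] ->] /=; split=> //.
  + exact: add_u.
  + exact: subsetUr.
  + by rewrite cardsU1 nu.
  + by rewrite subUset sub1set uV (subset_trans sV) ?subD1set.
- move=> _ _ r /imsetP[s /[!inE] /andP[sV _] ->] /imsetP[t /[!inE] /andP[tV _] ->].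
  rewrite /partner /= => sr tr; suff -> : s = t by [].
  have key (a : {set T}) : a \subset V :\ u -> (a == r) || (u |: a == r) -> a = r :\ u.
    move=> aV; have na := nu a aV; case/orP=> /eqP<-; last by rewrite setU1K.
    by apply/setP=> x; rewrite !inE; case: eqP => [->|]; rewrite ?(negPf na).
  exact: etrans (key s sV sr) (esym (key t tV tr)).
- move=> _ _ /imsetP[s /[!inE] /andP[sV _] ->] /imsetP[t /[!inE] /andP[tV _] ->] /= ne.
  move=> /subsetP tus; apply: proper_card; rewrite properEneq.
  apply/andP; split; first by apply: contra_neq ne => ->.
  apply/subsetP => x xt; move: (tus x xt); rewrite !inE => /orP[/eqP xu|//].
  by have := nu t tV; rewrite -xu xt.
- rewrite leqn0 cards_eq0; apply/eqP/setP => s; rewrite !inE.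
  apply/negP => /and3P[sV si /forall_inP crit].
  have subV : s :\ u \subset V :\ u by rewrite setSD.
  have /crit : (s :\ u, u |: s :\ u) \in M.
    apply/imsetP; exists (s :\ u) => //.
    by rewrite inE subV (indepS _ si) // subD1set.
  rewrite /partner /=; have [us|us] := boolP (u \in s).
    by rewrite setD1K // eqxx orbT.
  have -> : s :\ u = s.
    by apply/setP=> x; rewrite !inE; case: eqP => [->|]; rewrite ?(negPf us).
  by rewrite eqxx.
Qed.

(** Independent sets containing [v] correspond to those avoiding [v] and its neighbours, so [M2] is
    lifted by adding [v] and united with [M1]. *)
Lemma ranked_matching_branch (V : {set T}) v M1 f1 M2 f2 :
  v \in V -> ranked_matching (V :\ v) M1 f1 ->
  ranked_matching (V :\ v :\: nbhd v) M2 f2 ->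
  exists M f, ranked_matching V M f /\
    #|critical V M| <= #|critical (V :\ v) M1| + #|critical (V :\ v :\: nbhd v) M2|.
Proof.
move=> vV [shape1 disj1 desc1] [shape2 disj2 desc2].
pose lift (p : {set T} * {set T}) := (v |: p.1, v |: p.2).
pose drop (p : {set T} * {set T}) := (p.1 :\ v, p.2 :\ v).
pose M := M1 :|: [set lift p | p in M2].
(* Lifted pairs rank above all of [M1]: a step may leave the lifted part but never return, as no set
   containing [v] lies in one avoiding it. *)
pose f (p : {set T} * {set T}) :=
  if v \in p.1 then (f2 (drop p) + \max_(q in M1) f1 q).+1 else f1 p.
exists M, f.
have nv1 (p : {set T} * {set T}) : p \in M1 -> (v \notin p.1) * (v \notin p.2).
  case/shape1=> _ _ /subsetP s12 _ /subsetP s2.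
  have n2 : v \notin p.2 by apply/negP => /s2; rewrite !inE eqxx.
  by split=> //; apply: contra n2 => /s12.
have nv2 (p : {set T} * {set T}) : p \in M2 -> (v \notin p.1) * (v \notin p.2).
  case/shape2=> _ _ /subsetP s12 _ /subsetP s2.
  have n2 : v \notin p.2 by apply/negP => /s2; rewrite !inE eqxx andbF.
  by split=> //; apply: contra n2 => /s12.
have liftK p : p \in M2 -> drop (lift p) = p.
  by move=> /nv2 n; rewrite /drop /lift /= !setU1K ?n //; case: (p).
have indv (s : {set T}) : indep e s -> s \subset V :\ v :\: nbhd v -> indep e (v |: s).
  move=> si /subsetP sV; apply: indep_setU1 => // w /sV.
  by rewrite !inE => /andP[].
split; first split.
- move=> p /setUP[/shape1[? ? ? ? sV]|/imsetP[q qM ->]].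
    by split=> //; rewrite (subset_trans sV) ?subD1set.
  have n := nv2 q qM.
  case/shape2: qM => i1 i2 s12 c2 sV; have s1V := subset_trans s12 sV.
  rewrite /=; split; rewrite ?indv ?setUS ?cardsU1 ?n ?c2 //.
  rewrite subUset sub1set vV; apply: subset_trans sV _.
  by apply/subsetP => x; rewrite !inE => /and3P[].
- have vl q s : q \in M2 -> partner (lift q) s -> v \in s /\ partner q (s :\ v).
    move=> /nv2 n; rewrite /partner /= => /orP[] /eqP <-;
      by rewrite !inE eqxx setU1K ?n ?eqxx ?orbT.
  have v1 q s : q \in M1 -> partner q s -> v \notin s.
    by move=> /nv1 n /orP[] /eqP <-; rewrite n.
  move=> p q s /setUP[pM|/imsetP[p0 pM ->]] /setUP[qM|/imsetP[q0 qM ->]] ps qs.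
  + exact: disj1 ps qs.
  + by have [vs _] := vl _ _ qM qs; have := v1 _ _ pM ps; rewrite vs.
  + by have [vs _] := vl _ _ pM ps; have := v1 _ _ qM qs; rewrite vs.
  + have [_ ps'] := vl _ _ pM ps; have [_ qs'] := vl _ _ qM qs.
    by rewrite (disj2 _ _ _ pM qM ps' qs').
- move=> p q /setUP[pM|/imsetP[p0 pM ->]] /setUP[qM|/imsetP[q0 qM ->]] ne sub.
  + by rewrite /f (negPf (nv1 p pM).1) (negPf (nv1 q qM).1); apply: desc1.
  + have /negP[] := (nv1 _ pM).2; apply: (subsetP sub); exact: setU11.
  + rewrite {1}/f (negPf (nv1 _ qM).1) /f /= setU11 ltnS.
    exact/leq_trans/leq_addl/leq_bigmax_cond.
  + rewrite /f /= !setU11 !liftK // ltnS ltn_add2r; apply: desc2 => //.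
      by apply: contra_neq ne => ->.
    move/subsetP: sub => sub; apply/subsetP => x xq.
    have := sub x; rewrite /= !inE xq orbT => /(_ isT) /orP[/eqP xv|//].
    by have := (nv2 _ qM).1; rewrite -xv xq.
- apply: leq_trans (_ : #|critical (V :\ v) M1 :|:
      [set v |: s | s in critical (V :\ v :\: nbhd v) M2]| <= _); last first.
    apply: leq_trans (leq_card_setU _ _) _.
    by rewrite leq_add2l leq_imset_card.
  apply/subset_leq_card/subsetP => s; rewrite inE => /and3P[sV si /forall_inP crit].
  apply/setUP; have [vs|vs] := boolP (v \in s); [right|left].
    apply/imsetP; exists (s :\ v); last by rewrite setD1K.
    rewrite inE (indepS _ si) ?subD1set //; apply/and3P; split=> //.
      apply/subsetP => x; rewrite !inE => /andP[xv xs].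
      by rewrite xv (subsetP sV) ?(indepP _ si).
    apply/forall_inP => p pM; apply/negP => ps.
    have /crit/negP[] : lift p \in M by rewrite inE imset_f ?orbT.
    have n := nv2 _ pM.
    by case/orP: ps => /eqP h; rewrite /partner /= h setD1K ?eqxx ?orbT.
  rewrite inE si; apply/and3P; split=> //.
    apply/subsetP => x xs; rewrite !inE (subsetP sV) // andbT.
    by apply: contraNneq vs => <-.
  by apply/forall_inP => p pM; apply: crit; rewrite inE pM.
Qed.

Lemma mtree_ranked_matching V n : mtree V n ->
  exists M f, ranked_matching V M f /\ #|critical V M| <= n.
Proof.
elim=> {V n} [|V u uV uiso|V v a b vV _ [M1 [f1 [R1 c1]]] _ [M2 [f2 [R2 c2]]]].
- by exists set0, (fun=> 0); apply: ranked_matching_empty.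
- exact: ranked_matching_isolated uV uiso.
- have [M [f [R c]]] := ranked_matching_branch vV R1 R2.
  by exists M, f; split=> //; apply: leq_trans c (leq_add _ _).
Qed.

Lemma mtree_c_is n c : mtree [set: T] n -> c_is e c -> c <= n.
Proof.
case/mtree_ranked_matching=> M [f [R crit]] [_ min].
apply: leq_trans crit; apply: leq_trans (min M _ (ranked_matching_acyclic R)) _.
  case: R => shape disj _; split=> [p /shape[]//|p q pM qM ne].
  apply/pred0P => s /=; rewrite !inE; apply/negP => /andP[ps qs].
  case/eqP: ne; apply: (disj p q s) => //; rewrite /partner.
    by rewrite !(eq_sym _ s).
  by rewrite !(eq_sym _ s).
apply/subset_leq_card/subsetP => s; rewrite !inE subsetT => /andP[-> /=].
move=> /forall_inP h; apply/forall_inP => p /h.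
by rewrite /partner negb_or.
Qed.

End MatchingTree.

(** * Fibonacci and Lucas bounds for walk counts *)

Lemma fibSS n : fib n.+2 = fib n.+1 + fib n.
Proof. by []. Qed.

Lemma lucasSS n : lucas n.+2 = fib n.+1 + fib n.+3.
Proof. by []. Qed.

Lemma lucasS_leq n : 0 < n -> lucas n <= lucas n.+1.
Proof.
by case: n => [//|[//|n]] _; rewrite !lucasSS !fibSS; lia.
Qed.

Lemma lucas_leq m n : 0 < m -> m <= n -> lucas m <= lucas n.
Proof.
move=> m0; elim: n => [|n IH]; first by lia.
rewrite leq_eqVlt => /orP[/eqP-> //|lt].
by apply: leq_trans (IH _) (lucasS_leq _); lia.
Qed.

Lemma lucas_gt0 n : 0 < lucas n.
Proof. by case: n => [//|n]; apply: leq_trans (@lucas_leq 1 n.+1 _ _). Qed.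

(* Branching along a path of vertices has three states before the next vertex:
   O, the path so far is gone and imposes nothing; F, the previous vertex has
   become a leaf, so the next one is taken; I, the previous vertex was taken, so
   the next one is gone. A triple counts the surviving branches from (O, F, I);
   at the end of the path a pending leaf is isolated, whence (1, 0, 1). *)
Definition walk : Type := nat * nat * nat.

Definition wO (t : walk) : nat := t.1.1.
Definition wF (t : walk) : nat := t.1.2.
Definition wI (t : walk) : nat := t.2.

(** From O a high vertex is branched on, leading to O or I, while a low one becomes a leaf, state F.
    From F the vertex is taken; from I it is gone. *)
Definition walk_step (high : bool) (t : walk) : walk :=
  if high then (wO t + wI t, wI t, wO t) else (wF t, wI t, wO t).

Definition walks (s : seq bool) : walk := foldr walk_step (1, 0, 1) s.

Definition entries_le (h : nat) (t : walk) : Prop :=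
  [/\ wO t <= fib h.+2, wF t <= fib h.+2 & wI t <= fib h.+2] /\
  [/\ wO t + wF t <= fib h.+3, wF t + wI t <= fib h.+3 & wO t + wI t <= fib h.+3].

(** Only distinct states are paired: a low vertex permutes the states of both triples alike, and the
    final sum pairs [wO] with [wI]. *)
Definition cross_le (b : nat) (t u : walk) : Prop :=
  [/\ wO t + wF u <= b, wO t + wI u <= b & wF t + wO u <= b] /\
  [/\ wF t + wI u <= b, wI t + wO u <= b & wI t + wF u <= b].

(* [t] and [u] count the branches in which the first vertex of the cycle is left
   out, resp. taken; in the second case the last vertex of the cycle is missing,
   so the counts differ by one step. The low vertices between two high ones
   permute the states, hence at most one of [t], [u] profits from the last high
   vertex and at most one from the first: this turns the bound fib (h + 3) on the
   sum of two walk counts into lucas (h + 1). *)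
Definition pair_inv (h : nat) (t u : walk) : Prop :=
  match h with
  | 0 => [\/ (t, u) = ((0, 1, 1), (1, 0, 1)), (t, u) = ((1, 1, 0), (0, 1, 1))
         | (t, u) = ((1, 0, 1), (1, 1, 0))]
  | h'.+1 => (entries_le h t /\ entries_le h' u \/ entries_le h' t /\ entries_le h u)
             /\ cross_le (lucas h.+1) t u
  end.

Lemma pair_inv_step (b : bool) h t u :
  pair_inv h t u -> pair_inv (b + h) (walk_step b t) (walk_step b u).
Proof.
case: h => [|h].
  case=> -[-> ->]; case: b => /=; rewrite /entries_le /cross_le /=;
    by [split; [left|] | split; [right|] |
        constructor 1 | constructor 2 | constructor 3].
case: t u => [[o f] i] [[o' f'] i'].
case: b; rewrite ?add0n ?add1n /pair_inv !lucasSS /entries_le /cross_le /walk_step /wO /wF /wI.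
  (* At a high vertex the new cross bounds follow from the entry bounds alone, since [lucas h.+3] is
     [fib h.+2 + fib h.+4]. *)
  rewrite !(fibSS h.+3) !(fibSS h.+2) !(fibSS h.+1) !(fibSS h).
  move: (fib h.+1) (fib h) => a c.
  case=> [[] [[[? ? ?] [? ? ?]] [[? ? ?] [? ? ?]]] _]; cbn [fst snd] in *;
    (split; [|split; split; lia]).
    by left; split; split; split; lia.
  by right; split; split; split; lia.
case=> [[] [[[? ? ?] [? ? ?]] [[? ? ?] [? ? ?]]] [[? ? ?] [? ? ?]]]; cbn [fst snd] in *;
    (split; [|by split; split]).
  by left; split; split; split; rewrite // addnC.
by right; split; split; split; rewrite // addnC.
Qed.

Lemma closed_walks_leq (b : bool) (s : seq bool) g :
  2 < g -> (0 < count id (rcons s b) -> count id (rcons s b) < g) ->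
  wO (walks (rcons s b)) + wI (walks s) <= lucas g.
Proof.
move=> g2 le_g.
have inv : pair_inv (count id (rcons s b)) (walks (rcons s b)) (walks s).
  rewrite /walks foldr_rcons -cats1 count_cat /= addn0.
  elim: s {le_g} => [|c s IH] /=; last by rewrite -addnA; apply: pair_inv_step.
  by case: b; [split; first left|constructor 1].
case: (count id _) inv le_g => [|h] inv le_g.
  (* Without high vertices up to two walks survive, more than [lucas 1]; here [2 < g] makes room. *)
  apply: leq_trans (@lucas_leq 3 g _ _) => //.
  by case: inv => -[-> ->].
by case: inv => _ [[_ le _] _]; apply: leq_trans le (lucas_leq _ (le_g _)).
Qed.

(** * Branching along a path *)

Section Branching.

Variables (T : finType) (e : rel T).
Hypothesis simple : simple_graph e.

Definition tree_le (V : {set T}) (n : nat) : Prop := exists2 a, mtree e V a & a <= n.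

Lemma tree_leW V m n : m <= n -> tree_le V m -> tree_le V n.
Proof. by move=> mn [a ta am]; exists a => //; apply: leq_trans mn. Qed.

Lemma tree_le_isolated (V : {set T}) u n :
  u \in V -> (forall w, w \in V -> ~~ e u w) -> tree_le V n.
Proof. by move=> uV uiso; exists 0 => //; apply: MTIsolated uV uiso. Qed.

Lemma tree_le_branch (V : {set T}) v m n : v \in V ->
  tree_le (V :\ v) m -> tree_le (V :\ v :\: nbhd e v) n -> tree_le V (m + n).
Proof.
by move=> vV [a ta am] [b tb bn]; exists (a + b); [apply: MTBranch vV ta tb|lia].
Qed.

Lemma tree_le_leaf (V : {set T}) u v n :
  u \in V -> v \in V -> u != v -> (forall w, w \in V -> e u w -> w = v) ->
  tree_le (V :\ v :\: nbhd e v) n -> tree_le V n.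
Proof.
move=> uV vV uv leaf; rewrite -[n in tree_le V n]add0n; apply: tree_le_branch vV _.
apply: (@tree_le_isolated _ u); first by rewrite !inE uv.
by move=> w /setD1P[wv wV]; apply/negP => /(leaf _ wV)/eqP; apply/negP.
Qed.

Definition degV (V : {set T}) (x : T) : nat := #|[set y in V | e x y]|.

Variable V : {set T}.

(** The degree is taken in the ambient [V], not in the shrinking subproblem; later losses are
    tracked by the walk state. *)
Definition low (x : T) : bool := degV V x == 2.

(* Nonconsecutive vertices of degree at least three may be joined by chords. *)
Fixpoint chain (s : seq T) : bool :=
  if s is x :: s' then
    [&& if s' is y :: _ then e x y else true,
        all (fun z => low x || low z ==> ~~ e x z) (behead s') & chain s']
  else true.

Lemma low_nbrs z p q w :
  low z -> p \in V -> q \in V -> p != q -> e z p -> e z q ->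
  w \in V -> e z w -> (w == p) || (w == q).
Proof.
move=> /eqP dz pV qV pq zp zq wV zw; apply/negPn; rewrite negb_or.
apply/negP => /andP[wp wq]; suff: 2 < degV V z by rewrite dz.
apply: leq_trans (_ : #|[set w; p; q]| <= _).
  by rewrite -setUA !cardsU1 cards1 !inE negb_or wp wq pq.
  by apply/subset_leq_card/subsetP=> v; rewrite !inE => /orP[/orP[]|] /eqP->;
  rewrite ?wV ?pV ?qV ?zw ?zp ?zq.
Qed.

(** The only neighbours of a low vertex of [s] are its predecessor and successor on the path, so no
    chord ends there. [x] and [y] may coincide, as for a cycle cut open at one vertex. *)
Lemma chain_path s x y :
  uniq s -> x \notin s -> y \notin s -> {subset s <= V} -> x \in V -> y \in V ->
  path e x (rcons s y) -> chain s.
Proof.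
have [sym irr] := simple.
move=> + + ys + + yV.
elim: s x ys => [//|a s IH] x; rewrite inE negb_or => /andP[ya ys].
move=> /andP[as_ us]; rewrite inE negb_or => /andP[xa xs] sV xV.
rewrite rcons_path /= => /andP[/andP[xea pas] las].
have aV : a \in V by apply: sV; rewrite mem_head.
have sV' : {subset s <= V} by move=> z zs; apply: sV; rewrite inE zs orbT.
have -> : chain s by apply: (IH a); rewrite // rcons_path pas.
rewrite andbT; case: s {IH sV} as_ us xs pas las ys sV' => [//|b s] as_ us xs pas las ys sV.
move: pas => /= /andP[eab pbs]; rewrite eab /=.
have bV : b \in V by apply: sV; rewrite mem_head.
apply/allP => z zs; apply/implyP.
have zV : z \in V by apply: sV; rewrite inE zs orbT.
case/orP=> lz; apply/negP => az.
  have xb : x != b by move: xs; rewrite inE negb_or => /andP[].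
  move: xs us; rewrite inE negb_or => /andP[_ xs] /= /andP[bs _].
  have := low_nbrs (w := z) lz xV bV xb; rewrite sym xea eab => /(_ isT isT zV az).
  by case/orP=> /eqP zE; [rewrite -zE zs in xs|rewrite -zE zs in bs].
case/splitPr: s / zs as_ us xs ys sV pbs las => s1 s2 as_ us xs ys sV pbs las.
have lV : last b s1 \in V.
  by apply: sV; rewrite -cat_cons mem_cat mem_last.
have nV : head y s2 \in V.
  by case: (s2) sV => [//|c s3] sV; apply: sV; rewrite !(inE, mem_cat) eqxx !orbT.
have zl : e (last b s1) z by move: pbs; rewrite cat_path /= => /and3P[].
have zn : e z (head y s2).
  move: pbs las; rewrite cat_path /= last_cat /= => /and3P[_ _].
  by case: (s2) => [//|c s3] /= /andP[].
have ln : last b s1 != head y s2.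
  have lin : last b s1 \in b :: s1 by rewrite mem_last.
  apply/eqP => eq; rewrite eq in lin.
  have : y \notin (b :: s1) ++ z :: s2 by [].
  have : uniq ((b :: s1) ++ z :: s2) by [].
  rewrite cat_uniq mem_cat => /and3P[_ /hasPn no _].
  case: (s2) no lin => [|c s3] no lin; rewrite /= in lin; first by rewrite lin.
  by have := no c; rewrite !inE eqxx orbT -[_ || _]/(c \in b :: s1) lin => /(_ isT).
have := low_nbrs (w := a) lz lV nV ln; rewrite (sym z) zl zn (sym z) az.
move=> /(_ isT isT aV isT) /orP[] /eqP aE; move: as_.
  by rewrite -cat_cons mem_cat aE mem_last.
case: (s2) aE => [/= aE|c s3 /= ->]; first by rewrite aE eqxx in ya.
by rewrite !(inE, mem_cat) eqxx !orbT.
Qed.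


Variables (C : {set T}) (P : nat).
Hypothesis low_nbrs_in : forall z w, z \in C -> low z -> w \in V -> e z w -> w \in C.
Hypothesis base : forall W : {set T}, W \subset V -> [disjoint W & C] -> tree_le W P.

(** [s] is the part of [C] still ahead. A chord from a taken vertex may already have deleted a high
    vertex of it, but low ones are intact. *)
Definition open_at (W : {set T}) (s : seq T) : Prop :=
  [/\ W \subset V, forall x, x \in W -> x \in C -> x \in s
    & forall x, x \in s -> low x -> x \in W].

Definition flags (s : seq T) : seq bool := [seq ~~ low x | x <- s].

Lemma walks_behead s : wI (walks s) = wO (walks (behead s)).
Proof. by case: s => [|[] s]. Qed.

Lemma chain_behead s : chain s -> chain (behead s).
Proof. by case: s => [//|x s] /= /and3P[]. Qed.

(** By [chain], taking [y] deletes no low vertex beyond its successor, so the walk resumes just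
    after that successor. *)
Lemma open_at_remove (W : {set T}) y s :
  chain (y :: s) -> uniq (y :: s) -> y \in C -> open_at W (y :: s) ->
  open_at (W :\ y) s /\ open_at (W :\ y :\: nbhd e y) (behead s).
Proof.
have [sym irr] := simple.
move=> /= /and3P[ys /allP far _] /andP[nys us] yC [WV WC Wl].
have WyV : W :\ y \subset V by rewrite (subset_trans _ WV) ?subD1set.
split; split=> //.
- by move=> x /setD1P[xy xW] /(WC x xW); rewrite inE (negPf xy).
- move=> x xs lx; rewrite !inE Wl ?inE ?xs ?orbT // andbT.
  by apply: contraNneq nys => <-.
- by rewrite (subset_trans _ WyV) ?subsetDl.
- move=> x /setDP[/setD1P[xy xW]]; rewrite inE => nyx /(WC x xW).
  rewrite inE (negPf xy) /=; case: (s) ys => [//|z s'] yz /=.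
  by rewrite inE => /orP[/eqP xz|//]; rewrite xz yz in nyx.
- move=> x xs lx; have := far x xs; rewrite lx orbT /= => nyx.
  have {}xs := mem_behead xs.
  rewrite !inE nyx Wl ?inE ?xs ?orbT // andbT.
  by apply: contraNneq nys => <-.
Qed.

(** States O and F need a joint induction on length, because a low vertex turns O into F; in F the
    pending leaf [x] is still present. State I is O one vertex later, by [walks_behead]. *)
Lemma tree_le_walk s W :
  chain s -> uniq s -> {subset s <= C} ->
  (open_at W s -> tree_le W (wO (walks (flags s)) * P)) /\
  (forall x, x \in C -> low x -> chain (x :: s) -> uniq (x :: s) ->
     open_at W (x :: s) -> tree_le W (wF (walks (flags s)) * P)).
Proof.
have [sym irr] := simple.
have [n] := ubnP (size s); elim: n s W => [//|n IH] s W sn ch us sC.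
have Fcase x : x \in C -> low x -> chain (x :: s) -> uniq (x :: s) ->
    open_at W (x :: s) -> tree_le W (wF (walks (flags s)) * P).
  move=> xC lx chx usx openW; have [WV WC Wl] := openW.
  have xW : x \in W by apply: Wl; rewrite ?mem_head.
  (* Neighbours of the low [x] lie in [C]; those left in [W] lie in [s], and [chain] permits only
     the first. *)
  have xnbr w : w \in W -> e x w -> exists2 y, s = y :: behead s & w = y.
    move=> wW xw; have wC := low_nbrs_in xC lx (subsetP WV w wW) xw.
    have := WC w wW wC; rewrite inE; case: eqP => [wx|_ /= ws].
      by rewrite wx irr in xw.
    case/and3P: chx => _ /allP far _; case: (s) ws far => [//|y s'].
    rewrite inE => /orP[/eqP-> _|ws' far]; first by exists y.
    by have := far w ws'; rewrite lx xw.
  (* The successor may be missing; then [x] is isolated and the branch costs nothing. *)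
  have [y /andP[/= yW xy]|no] := pickP [pred y in W | e x y]; last first.
    apply: (tree_le_isolated _ xW) => w wW; apply/negP => xw.
    by have := no w; rewrite /= wW xw.
  have [z sz yz] := xnbr y yW xy; rewrite -{}yz {z} in sz.
  have nyx : x != y by apply: contraTneq xy => ->; rewrite irr.
  apply: (tree_le_leaf xW yW nyx).
    by move=> w wW /(xnbr w wW) [z]; rewrite sz => -[<-].
  have yC : y \in C by apply: sC; rewrite sz mem_head.
  have [openx _] := open_at_remove chx usx xC openW.
  have [_ openy] : open_at (W :\ x :\ y) (behead s) /\
     open_at (W :\ x :\ y :\: nbhd e y) (behead (behead s)).
    by apply: open_at_remove yC _; rewrite -sz.
  (* As a neighbour of [y], [x] is deleted anyway, so applying [open_at_remove] twice reaches the
     right set. *)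
  have -> : W :\ y :\: nbhd e y = W :\ x :\ y :\: nbhd e y.
    apply/setP => w; rewrite !inE; case: (w =P x) => [->|_] //.
    by rewrite sym xy.
  have -> : wF (walks (flags s)) = wO (walks (flags (behead (behead s)))).
    case: (s) sz => [//|z s'] _ /=; rewrite /flags -behead_map -walks_behead.
    by rewrite /walk_step; case: ifP.
  have [] := IH (behead (behead s)) (W :\ x :\ y :\: nbhd e y).
  - rewrite !size_behead; move: sn; have : 0 < size s by rewrite sz.
    by case: (size s) => [//|m] _ /= mn; apply: leq_ltn_trans (leq_pred m) mn.
  - by do 2 apply: chain_behead.
  - by apply: subseq_uniq us; rewrite -!drop1 drop_drop drop_subseq.
  - by move=> w /mem_behead /mem_behead /sC.
  - by move=> H _; apply: H.
split; last exact: Fcase.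
case: s sn ch us sC {Fcase} => [|y s] sn ch us sC openW.
  have [WV WC _] := openW; rewrite mul1n; apply: base => //.
  by apply/pred0P => x /=; apply/negP => /andP[xW /(WC x xW)].
have yC : y \in C by apply: sC; rewrite mem_head.
have sC' : {subset s <= C} by move=> w ws; apply: sC; rewrite inE ws orbT.
have chs : chain s := chain_behead ch.
have uss : uniq s by case/andP: us.
rewrite /=; have [ly|hy] := boolP (low y).
  have [] := IH s W sn chs uss sC'.
  by move=> _ /(_ y yC ly ch us openW).
have [openO openI] := open_at_remove ch us yC openW.
rewrite /= /wO /= -/(wO _) mulnDl walks_behead behead_map.
have tO V' : open_at V' s -> tree_le V' (wO (walks (flags s)) * P).
  by have [] := IH s V' sn chs uss sC'.
have tI V' : open_at V' (behead s) -> tree_le V' (wO (walks (flags (behead s))) * P).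
  have [] := IH (behead s) V' _ (chain_behead chs) _ _ => //.
  - by rewrite size_behead; move: sn => /=; lia.
  - by apply: subseq_uniq uss; rewrite -drop1 drop_subseq.
  - by move=> w /mem_behead /sC'.
(* If a chord has already deleted the high [y], the first of the two counts suffices. *)
have [yW|yW] := boolP (y \in W).
  by apply: tree_le_branch yW _ _; [apply: tO|apply: tI].
apply: tree_leW (leq_addr _ _) _; apply: tO.
have -> : W = W :\ y by apply/setP=> x; rewrite !inE; case: eqP => [->|]; rewrite ?(negPf yW).
by [].
Qed.

End Branching.

(** * Consuming a cycle *)

Section Cycle.

Variables (T : finType) (e : rel T) (V : {set T}).
Hypothesis simple : simple_graph e.

Lemma gcycle_rot c i : gcycle e c -> gcycle e (rot i c).
Proof. by case=> c3 cU cc; split; rewrite ?size_rot ?rot_uniq ?rot_cycle. Qed.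

(** Branch on [x] first. Leaving it out starts the walk in O along all other vertices; taking it
    deletes both its cycle neighbours, and the walk covers what lies between them. *)
Lemma tree_le_gcycle_cons x s P g :
  gcycle e (x :: s) -> {subset x :: s <= V} -> 2 < g ->
  (0 < count (fun y => ~~ low e V y) s -> count (fun y => ~~ low e V y) s < g) ->
  (forall W : {set T}, W \subset V -> [disjoint W & [set y in x :: s]] -> tree_le e W P) ->
  tree_le e V (lucas g * P).
Proof.
have [sym irr] := simple.
move=> cyc cV g2 cnt base.
have lowC z w : z \in [set y in x :: s] -> low e V z -> w \in V -> e z w ->
    w \in [set y in x :: s].
  rewrite !inE -!(in_cons x) => zc lz wV zw.
  have [i s' def] := rot_to zc; have := gcycle_rot i cyc.
  rewrite -(mem_rot i); have : {subset z :: s' <= V}.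
    by move=> v; rewrite -def mem_rot => /cV.
  rewrite def => {def} sV; case: s' sV => [|a s'] sV; first by case.
  case/lastP: s' sV => [|s' b] sV [// _ zU zP].
  have ab : a != b.
    by case/and3P: zU => _; rewrite mem_rcons inE negb_or => /andP[].
  have aV : a \in V by apply: sV; rewrite !inE eqxx orbT.
  have bV : b \in V by apply: sV; rewrite !(inE, mem_rcons) eqxx !orbT.
  move: zP; rewrite /= rcons_path last_rcons => /and3P[za _ bz].
  have := low_nbrs lz aV bV ab za _ wV zw; rewrite sym => /(_ bz).
  by case/orP=> /eqP->; rewrite !(inE, mem_rcons) eqxx ?orbT.
case: s cyc cV cnt base lowC => [|y s]; first by case.
case/lastP: s => [|s z]; first by case.
move=> [_ xU xP] cV cnt base lowC.
have inV v : v \in [:: x, y & rcons s z] -> v \in V by apply: cV.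
have xV : x \in V by rewrite inV ?mem_head.
have yV : y \in V by rewrite inV // !inE eqxx orbT.
have zV : z \in V by rewrite inV // !(inE, mem_rcons) eqxx !orbT.
have sV v : v \in s -> v \in V.
  by move=> vs; rewrite inV // !(inE, mem_rcons) vs !orbT.
move: (xU); rewrite /= rcons_uniq !(inE, mem_rcons) !negb_or.
move=> /and3P[/and3P[xy xz xs] /andP[yz ys] /andP[zs sU]].
move: (xP); rewrite /= rcons_path last_rcons => /and3P[exy pyz ezx].
have outch : chain e V (y :: rcons s z).
  apply: (@chain_path _ _ simple _ _ x x) => //.
  - by case/andP: xU.
  - by rewrite !(inE, mem_rcons) !negb_or xy xz.
  - by rewrite !(inE, mem_rcons) !negb_or xy xz.
  - by move=> v vs; apply: inV; rewrite inE vs orbT.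
(* With [x] at its head, this chain shows that taking [x] deletes no low vertex of [s]. *)
have inch : chain e V [:: x, y & s].
  apply: (@chain_path _ _ simple _ _ z z) => //.
  - by rewrite /= !inE !negb_or xy xs ys sU.
  - by rewrite !inE !negb_or ![z == _]eq_sym xz yz zs.
  - by rewrite !inE !negb_or ![z == _]eq_sym xz yz zs.
  - by move=> v; rewrite !inE => /or3P[/eqP->|/eqP->|/sV].
  - by rewrite /= ezx exy.
pose fl := flags e V (y :: s); pose b := ~~ low e V z.
have flE : flags e V (y :: rcons s z) = rcons fl b by rewrite /flags /= map_rcons.
have {}cnt : 0 < count id (rcons fl b) -> count id (rcons fl b) < g.
  by rewrite -flE count_map.
apply: tree_leW (leq_mul (closed_walks_leq g2 cnt) (leqnn P)) _.
pose C := [set v in [:: x, y & rcons s z]].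
have sC v : v \in s -> v \in C by move=> vs; rewrite !(inE, mem_rcons) vs !orbT.
have walk t W := @tree_le_walk _ _ simple V C P lowC base t W.
rewrite mulnDl; apply: (tree_le_branch xV).
  rewrite -flE; have [//|||H _] := walk (y :: rcons s z) (V :\ x).
  - by case/andP: xU.
  - by move=> v vs; rewrite inE inE vs orbT.
  apply: H; split; first exact: subD1set.
    by move=> v; rewrite !inE => /andP[/negPf->].
  move=> v vs _; rewrite in_setD1 inV; last by rewrite in_cons vs orbT.
  by rewrite andbT; apply: contraTneq vs => ->; case/andP: xU.
rewrite walks_behead -[behead fl]/(flags e V s).
have [| //|//|H _] := walk s (V :\ x :\: nbhd e x).
  exact: (chain_behead (chain_behead inch)).
apply: H; split.
- by apply: subset_trans (subsetDl _ _) (subD1set _ _).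
- move=> v; rewrite !(inE, mem_rcons) => /and3P[xv vx _].
  case/or4P=> // /eqP vE; first by rewrite vE eqxx in vx.
    by rewrite vE exy in xv.
  by rewrite vE sym ezx in xv.
- move=> v vs lv; rewrite !inE sV // andbT.
  apply/andP; split; last by apply: contraTneq vs => ->.
  by case/and3P: inch => _ /allP/(_ v vs); rewrite lv orbT.
Qed.

(** Rotating a high vertex to the front, if there is one, leaves fewer than [g] of them for the
    walk. *)
Lemma tree_le_gcycle c P g :
  gcycle e c -> {subset c <= V} -> 2 < g -> count (fun y => ~~ low e V y) c <= g ->
  (forall W : {set T}, W \subset V -> [disjoint W & [set y in c]] -> tree_le e W P) ->
  tree_le e V (lucas g * P).
Proof.
move=> cyc cV g2 cg base.
have [/hasP[x xc hx]|/negPf no] := boolP (has (fun y => ~~ low e V y) c).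
  have [i s def] := rot_to xc.
  have mem v : (v \in x :: s) = (v \in c) by rewrite -def mem_rot.
  apply: (@tree_le_gcycle_cons x s) => //.
  - by rewrite -def; apply: gcycle_rot.
  - by move=> v; rewrite mem => /cV.
  - have /permP/(_ (fun y => ~~ low e V y)) : perm_eq (x :: s) c.
      by rewrite -def perm_rot.
    by move=> cnt _; move: cg; rewrite -cnt /= hx.
  - move=> W WV dis; apply: base => //; apply: etrans dis.
    by apply: eq_disjoint_r => v; rewrite !inE -mem inE.
case: c cyc cV no {cg} base => [|x s]; first by case.
move=> cyc cV no base; apply: (@tree_le_gcycle_cons x s) => //.
by move: no; rewrite has_count /=; lia.
Qed.

End Cycle.

(** * Short cycles in graphs of minimal degree two *)

(** The path is extended at its start until all neighbours of [x] lie on it; one other than the next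
    vertex then closes a cycle. *)
Lemma gcycle_of_path (T : finType) (e : rel T) x p :
  simple_graph e -> min_deg_ge2 e -> path e x p -> uniq (x :: p) ->
  exists c, gcycle e c.
Proof.
move=> [sym irr] deg2.
have [n] := ubnP (#|T| - size p).
elim: n x p => [//|n IH] x p pn xp xpU.
have [y xy|no] := pickP [pred y | e x y & y \notin x :: p].
  case/andP: xy => /= xy yn; apply: (IH y (x :: p)).
  - have : size (y :: x :: p) <= #|T|.
      by rewrite -(card_uniqP _) ?max_card //= yn.
    by move: pn => /=; lia.
  - by rewrite /= sym xy.
  - by rewrite /= yn.
have nbr y : e x y -> y \in p.
  move=> xy; apply: contraFT (no y) => yp.
  rewrite /= xy inE negb_or yp andbT.
  by apply: contraTneq xy => ->; rewrite irr.
have [y xy yn] : exists2 y, e x y & y != head x p.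
  apply/exists_inP; apply: contraT => /exists_inPn H.
  have : deg e x <= #|[set head x p]|.
    apply/subset_leq_card/subsetP => y; rewrite !inE => xy.
    by have := H y xy; rewrite negbK.
  by rewrite cards1; have := deg2 x; lia.
have yp := nbr y xy; case: p {pn no nbr} yp xp xpU yn => [//|a p].
rewrite inE => /orP[/eqP->|]; first by rewrite eqxx.
case/splitPr=> p1 p2 xp xpU _; exists (x :: a :: rcons p1 y).
move: xp xpU; rewrite -cat_rcons -cat_cons cat_path -cat_cons cat_uniq.
move=> /andP[xap _] /andP[xapU _].
by split; rewrite // /cycle ?rcons_path ?xap /= ?last_rcons ?size_rcons // sym.
Qed.

(** Cycles repeat no vertex, so a minimum can be taken over the finite type of sequences of length
    at most [#|T|]. *)
Lemma eff_girth_exists (T : finType) (e : rel T) c0 : gcycle e c0 ->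
  exists c, gcycle e c /\ eff_girth_is e (high_on e c).
Proof.
move=> cyc0.
pose P (t : #|T|.-bseq T) := [&& 2 < size t, uniq t & cycle e t].
have bP c : gcycle e c -> exists2 t : #|T|.-bseq T, P t & t = c :> seq T.
  case=> c3 cU cc; have sz : size c <= #|T| by rewrite -(card_uniqP cU) max_card.
  by exists (Bseq sz) => //; apply/and3P.
have [t0 Pt0 _] := bP _ cyc0.
case: (arg_minnP (fun t : #|T|.-bseq T => high_on e t) Pt0) => t Pt min.
have cyct : gcycle e t by case/and3P: Pt.
exists t; split=> //; split; first by exists t.
by move=> c /bP [u Pu <-]; apply: min.
Qed.

Definition at_most_disjoint_cycles_in (T : finType) (e : rel T) (V : {set T}) k : Prop :=
  ~ exists cs, [/\ size cs = k.+1, disjoint_cycles e cs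
                 & forall c, c \in cs -> {subset c <= V}].

Lemma at_most_disjoint_cycles_inS (T : finType) (e : rel T) (V W : {set T}) k :
  W \subset V -> at_most_disjoint_cycles_in e V k -> at_most_disjoint_cycles_in e W k.
Proof.
move=> /subsetP WV am [cs [szcs disj csW]]; apply: am; exists cs.
by split=> // c ccs v vc; apply: WV; apply: csW vc.
Qed.

Section Induced.

Variables (T : finType) (e : rel T) (V : {set T}).

(** [g_is] quantifies over whole graphs, so [V] gets a vertex type of its own. *)
Definition induced : rel {x | x \in V} := relpre val e.

Lemma induced_simple : simple_graph e -> simple_graph induced.
Proof. by case=> sym irr; split=> [x y|x]; [apply: sym|apply: irr]. Qed.

Lemma deg_induced x : deg induced x = degV e V (val x).
Proof.
rewrite /deg /degV -(card_imset _ val_inj); apply: eq_card => y.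
rewrite inE; apply/imsetP/andP => [[z + ->]|[yV xy]].
  by rewrite inE => xz; split=> //; apply: (valP z).
by exists (exist _ y yV); rewrite ?inE.
Qed.

Lemma gcycle_induced c : gcycle induced c -> gcycle e (map val c).
Proof.
by case=> c3 cU cc; split; rewrite ?size_map ?(map_inj_uniq val_inj) ?cycle_map.
Qed.

Lemma map_val_sub (c : seq {x | x \in V}) : {subset map val c <= V}.
Proof. by move=> _ /mapP[x _ ->]; apply: valP. Qed.

Lemma at_most_disjoint_cycles_induced k :
  at_most_disjoint_cycles_in e V k -> at_most_disjoint_cycles induced k.
Proof.
move=> am [cs [szcs [cyc disj]]]; apply: am; exists (map (map val) cs).
split; first by rewrite size_map.
  split; first by move=> _ /mapP[c /cyc ccyc ->]; apply: gcycle_induced.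
  rewrite pairwise_map; apply: sub_pairwise disj => c d cd.
  rewrite /= disjoint_has; apply/hasPn => _ /mapP[x xc ->].
  by rewrite (mem_map val_inj); move: cd; rewrite disjoint_has => /hasPn; apply.
by move=> _ /mapP[c _ ->]; apply: map_val_sub.
Qed.

Hypothesis simple : simple_graph e.
Hypothesis deg2 : forall y, y \in V -> 2 <= degV e V y.

Lemma min_deg_induced : min_deg_ge2 induced.
Proof. by move=> y; rewrite deg_induced deg2 ?(valP y). Qed.

Lemma gcycle_induced_exists x : x \in V -> exists c, gcycle induced c.
Proof.
move=> xV; apply: (@gcycle_of_path _ _ (exist _ x xV) [::]) => //.
  exact: induced_simple.
exact: min_deg_induced.
Qed.

Lemma gcycle_exists x : x \in V -> exists c, gcycle e c /\ {subset c <= V}.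
Proof.
case/gcycle_induced_exists=> c cyc; exists (map val c).
by split; [apply: gcycle_induced|apply: map_val_sub].
Qed.

(** The effective girth of the induced graph is at most [g]; there minimal degree two makes [~~ low]
    mean degree at least three. *)
Lemma short_gcycle_exists k g x :
  g_is k g -> at_most_disjoint_cycles_in e V k -> x \in V ->
  exists c, [/\ gcycle e c, {subset c <= V} & count (fun y => ~~ low e V y) c <= g].
Proof.
case=> _ gmax am /gcycle_induced_exists[c0 cyc0].
have [c [cyc eff]] := eff_girth_exists cyc0.
exists (map val c); split; first exact: gcycle_induced.
  exact: map_val_sub.
have amI := at_most_disjoint_cycles_induced am.
have := gmax _ _ _ (And4 (induced_simple simple) min_deg_induced amI eff).
apply: leq_trans; rewrite count_map; apply/sub_count => y /=.
rewrite /low deg_induced => ne.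
by rewrite ltn_neqAle eq_sym ne deg2 ?(valP y).
Qed.

End Induced.

(* The cycles of K4 witness 3 <= g(k); this absorbs the cycles with fewer than
   two high vertices, where two branches may remain although lucas 1 = 1. *)
Definition K4 : rel 'I_4 := fun x y => x != y.

Lemma deg_K4 x : deg K4 x = 3.
Proof.
rewrite /deg (_ : [set y | K4 x y] = ~: [set x]); last first.
  by apply/setP=> y; rewrite !inE eq_sym.
by rewrite cardsC1 card_ord.
Qed.

(** Two disjoint cycles need six vertices, and all vertices of [K4] count as high. *)
Lemma g_is_gt2 k g : 0 < k -> g_is k g -> 2 < g.
Proof.
move=> k0 [_ gmax]; apply: (gmax _ K4); split.
- by split=> [x y|x]; rewrite /K4 ?eqxx // eq_sym.
- by move=> x; rewrite deg_K4.
- case=> cs [szcs [cyc]]; case: cs szcs cyc => [//|c [|d cs]] szcs cyc /=.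
    by move: szcs => /=; lia.
  case/andP=> /andP[cd _] _.
  have [c3 cU _] := cyc c (mem_head _ _).
  have [|d3 dU _] := cyc d; first by rewrite !inE eqxx orbT.
  have : size (c ++ d) <= #|'I_4|.
    rewrite -(card_uniqP _) ?max_card // cat_uniq cU dU andbT /=.
    by move: cd; rewrite disjoint_sym disjoint_has.
  by rewrite size_cat card_ord; lia.
- have cnt c : high_on K4 c = size c.
    by rewrite -count_predT; apply: eq_count => x; rewrite deg_K4.
  split; last by move=> c [c3 _ _]; rewrite cnt.
  pose o i (h : i < 4) : 'I_4 := Ordinal h.
  by exists [:: @o 0 isT; @o 1 isT; @o 2 isT]; rewrite cnt.
Qed.

(** * Induction on the number of disjoint cycles *)

(** Induction on [#|V|]: an isolated vertex gives 0, and a leaf passes to a smaller set. Pruning may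
    end at the empty set, which counts 1, whence [0 < n]. *)
Lemma tree_le_min_deg (T : finType) (e : rel T) k n :
  simple_graph e -> 0 < n ->
  (forall (V : {set T}) x, x \in V -> at_most_disjoint_cycles_in e V k ->
     (forall y, y \in V -> 2 <= degV e V y) -> tree_le e V n) ->
  forall V : {set T}, at_most_disjoint_cycles_in e V k -> tree_le e V n.
Proof.
move=> [_ irr] n0 H V; have [m] := ubnP #|V|; elim: m V => [//|m IH] V Vm am.
have [->|[x xV]] := set_0Vmem V; first by exists 1 => //; apply: MTEmpty.
have [|] := boolP [forall y in V, 2 <= degV e V y].
  by move/forall_inP => deg2; apply: H xV am deg2.
case/forall_inPn=> u uV; rewrite -ltnNge ltnS leq_eqVlt ltnS leqn0.
case/orP=> [/cards1P[v uv]|]; last first.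
  rewrite cards_eq0 => /eqP u0; apply: (tree_le_isolated _ uV) => w wV.
  by have /setP/(_ w) := u0; rewrite !inE wV /= => ->.
have leaf w : w \in V -> e u w -> w = v.
  by move=> wV uw; apply/set1P; rewrite -uv inE wV.
have : v \in [set y in V | e u y] by rewrite uv set11.
rewrite inE => /andP[vV euv].
have ne : u != v by apply: contraTneq euv => ->; rewrite irr.
have sub : V :\ v :\: nbhd e v \subset V :\ v by rewrite subsetDl.
apply: (tree_le_leaf uV vV ne leaf); apply: IH.
  have := subset_leq_card sub; move: Vm; rewrite (cardsD1 v V) vV; lia.
apply: at_most_disjoint_cycles_inS am.
exact: subset_trans sub (subD1set _ _).
Qed.

Lemma tree_le_product (T : finType) (e : rel T) (g : nat -> nat) k (V : {set T}) :
  simple_graph e -> (forall i, 1 <= i <= k -> g_is i (g i)) ->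
  at_most_disjoint_cycles_in e V k ->
  tree_le e V (\prod_(1 <= i < k.+1) lucas (g i)).
Proof.
move=> simple; elim: k V => [|k IH] V gk am; apply: tree_le_min_deg am => //.
- by rewrite big_geq.
(* For [k = 0], a nonempty set of minimal degree two would contain a forbidden cycle. *)
- move=> {}V x xV am deg2; have [c [cyc cV]] := gcycle_exists simple deg2 xV.
  case: am; exists [:: c]; split=> //; first split=> //.
    by move=> d; rewrite inE => /eqP->.
  by move=> d; rewrite inE => /eqP->.
- by apply: prodn_cond_gt0 => i _; apply: lucas_gt0.
- move=> {}V x xV am deg2; have gk1 : g_is k.+1 (g k.+1) by apply: gk; lia.
  have [c [cyc cV cg]] := short_gcycle_exists simple deg2 gk1 am xV.
  rewrite big_nat_recr //= mulnC; apply: (tree_le_gcycle simple cyc cV _ cg).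
    by apply: g_is_gt2 gk1.
  move=> W WV dis; apply: IH => [i ik|]; first by apply: gk; lia.
  (* Adding [c] to [k.+1] disjoint cycles in [W] would give one cycle too many in [V]. *)
  move=> [cs [szcs [csc disj] csW]]; apply: am; exists (c :: cs); split.
  + by rewrite /= szcs.
  + split; first by move=> d; rewrite inE => /orP[/eqP->|/csc].
    rewrite /= disj andbT; apply/allP => d dcs; rewrite disjoint_sym.
    rewrite disjoint_has; apply/hasPn => v vd; have := csW d dcs v vd.
    by apply: contraL => vc; rewrite (disjointFl dis) // inE.
  + move=> d; rewrite inE => /orP[/eqP->//|dcs] v vd.
    exact: (subsetP WV) (csW d dcs v vd).
Qed.

Theorem theorem3p5 (k : nat) (T : finType) (e : rel T) (g : nat -> nat) (cG : nat) :
  simple_graph e ->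
  at_most_disjoint_cycles e k ->
  (forall i, 1 <= i <= k -> g_is i (g i)) ->
  c_is e cG ->
  cG <= \prod_(1 <= i < k.+1) lucas (g i).
Proof.
move=> simple am gk cG_min.
have [|a ta le_a] := tree_le_product (V := [set: T]) simple gk.
  by case=> cs [szcs disj _]; apply: am; exists cs.
exact: leq_trans (mtree_c_is simple ta cG_min) le_a.
Qed.
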